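(* Let $s,t\ge1$ be integers, let $G$ be the type-$(s,t)$ bipartite graph on $[n]\sqcup[n']$, let $\mu$ be the sampling distribution on perfect matchings of $G$ of the sequential algorithm run in the top-down order, and let $\pi$ be a perfect matching of $G$. For each $i=1,2,\dots,n$, let $X_i=1$ if $\pi(i)=i-s$ and $X_i=0$ otherwise, and let $Y_i=\min(t+1,\,n-i)$. Then $$\mu(\pi)=\frac{(t+1)^{t-n}}{t!}\cdot\prod_{i=1}^n Y_i^{X_i}.$$ In particular, there exist constants $c_1=c_1(s,t)$ and $c_2=c_2(s,t)$ such that $$c_1(t+1)^{\theta(\pi)-n}\le\mu(\pi)\le c_2(t+1)^{\theta(\pi)-n},$$ where $\theta(\pi)=\sum_{i=1}^n X_i=|\{i:\pi(i)=i-s\}|$.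
   Context: Type-$(s,t)$ graph: the bipartite graph with left vertices $[n]=\{1,\dots,n\}$, right vertices $[n']=\{1',\dots,n'\}$, and an edge between $i$ and $j'$ ($1\le i,j\le n$) if and only if $-s\le j-i\le t$. A perfect matching is identified with the permutation $\pi$ of $\{1,\dots,n\}$ such that $i$ is matched to $\pi(i)'$. Sequential algorithm (top-down order): start with the empty matching $\pi_0$. For $i=1,2,\dots,n$ in order, let $J_i$ be the set of edges $e$ from vertex $i$ to a not-yet-matched right vertex such that $\pi_{i-1}\cup\{e\}$ can be completed to a perfect matching of $G$; choose $e\in J_i$ uniformly at random and set $\pi_i=\pi_{i-1}\cup\{e\}$. The output is the perfect matching $\pi=\pi_n$, and its probability is $\mu(\pi)=\prod_{i=1}^n|J_i|^{-1}$.
   Formalization: Y_i is corrected to min(t+1, n-i+1), since the printed Y_n = 0 fails (s=t=1, n=2, π the transposition: μ=1/2, formula 0), and the exact formula is stated for n ≥ t, since it fails for n < t (n=1, t=2: μ=1, formula 3/2); the bounds are for all n. *)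

(* Defs.v *)
From mathcomp Require Import all_boot all_order all_fingroup all_algebra.

Set Implicit Arguments.
Unset Strict Implicit.
Unset Printing Implicit Defensive.

Import Order.TTheory GRing.Theory Num.Theory.
Local Open Scope ring_scope.

(* Bipartite graphs on [n] and [n'] are given by their edge set; the element
   i : 'I_n stands for the vertex i + 1 of [n] (or of [n']), so differences of
   indices are unaffected by the shift. *)
Definition bigraph (n : nat) := {set 'I_n * 'I_n}.

Definition type_graph (s t n : nat) : bigraph n :=
  [set e : 'I_n * 'I_n | - s%:Z <= (e.2 : nat)%:Z - (e.1 : nat)%:Z <= t%:Z].

Definition matching_edges (n : nat) (p : 'S_n) : {set 'I_n * 'I_n} :=
  [set (i, p i) | i : 'I_n].

Definition perfect_matching (n : nat) (G : bigraph n) (p : 'S_n) : bool :=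
  matching_edges p \subset G.

Definition completable (n : nat) (G : bigraph n) (M : {set 'I_n * 'I_n}) : bool :=
  [exists p : 'S_n, perfect_matching G p && (M \subset matching_edges p)].

(* The set J_i of admissible edges at the left vertex i, when M is the partial
   matching built so far. *)
Definition J (n : nat) (G : bigraph n) (M : {set 'I_n * 'I_n}) (i : 'I_n) :
    {set 'I_n * 'I_n} :=
  [set e in G | [&& e.1 == i, e.2 \notin [set f.2 | f in M]
                  & completable G (e |: M)]].

(* The probability that the algorithm, started from the partial matching M and
   processing the left vertices of r in order, outputs the edge set T. *)
Fixpoint output_prob (R : realFieldType) (n : nat) (G : bigraph n)
    (r : seq 'I_n) (M T : {set 'I_n * 'I_n}) : R :=
  if r is i :: r' then
    \sum_(e in J G M i) #|J G M i|%:R^-1 * output_prob R G r' (e |: M) T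
  else (M == T)%:R.

(* enum 'I_n is increasing: this is the top-down order. *)
Definition mu (R : realFieldType) (n : nat) (G : bigraph n) (p : 'S_n) : R :=
  output_prob R G (enum 'I_n) set0 (matching_edges p).

Definition X (s n : nat) (p : 'S_n) (i : 'I_n) : nat :=
  ((p i : nat)%:Z == (i : nat)%:Z - s%:Z).

(* The vertex represented by i is i + 1, so n - i counts the left vertices from
   it to the last one: in 1-based indexing this is min (t + 1, n - i + 1), and
   it is always positive. *)
Definition Y (t n : nat) (i : 'I_n) : nat := minn t.+1 (n - i).

Definition theta (s n : nat) (p : 'S_n) : nat := (\sum_(i < n) X s p i)%N.

(* Main.v *)
Require Import Defs.
From mathcomp Require Import all_boot all_order all_fingroup all_algebra.
From mathcomp Require Import zify.

Import Order.TTheory GRing.Theory Num.Theory.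
Local Open Scope ring_scope.

(** Fix a perfect matching [p] of the type-(s,t) graph. Left vertices are
    matched in increasing order, so the only run of the algorithm that outputs [p]
    passes through the restrictions of [p] to initial segments of the rows, and
    [mu p] is the product of the inverses of the numbers of admissible edges
    met along this run ([mu_prod]).

    At row [i] there are two cases. If column [i - s] is still free, no later
    row reaches it, so it must be used now: one choice, and this is exactly the
    case [p i = i - s] ([J_forced]). Otherwise every free column [j <= i + t]
    may be chosen ([J_free]). Indeed, once all columns up to [i - s] are taken,
    a partial matching of the rows up to [i] extends to a perfect one by giving
    each next row the smallest free column: that column is never too far right
    by the pigeonhole principle, and each row raises the smallest free column by
    at least one, so it is never too far left ([greedy_completion]). Among
    the [min (i + t + 1, n)] columns up to [i + t], exactly [i] are taken,
    which leaves [Y i] choices ([card_J]).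

    Hence [mu p] is the product of [Y i ^ X i / Y i]. The product of all [Y i]
    is [t! (t + 1) ^ (n - t)] when [t <= n], which gives the exact formula. For
    the estimates, each factor is [1] if [X i = 1], and at least
    [1 / (t + 1)] otherwise, so [c1 = 1] works; and [Y i <= t + 1] for the
    numerators, with [(t + 1) ^ n <= (t + 1) ^ t * prod Y] for the
    denominators, gives [c2 = (t + 1) ^ t]. *)

(** * The output probability as a product *)

Definition prefix {n} (p : 'S_n) (k : nat) : {set 'I_n * 'I_n} :=
  [set (m, p m) | m : 'I_n & (m < k)%N].

Lemma in_matching n (p : 'S_n) (e : 'I_n * 'I_n) :
  (e \in matching_edges p) = (e.2 == p e.1).
Proof.
case: e => i j /=; apply/imsetP/eqP => [[m _ [-> ->]] //| ->].
by exists i.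
Qed.

Lemma in_prefix n (p : 'S_n) k (e : 'I_n * 'I_n) :
  (e \in prefix p k) = (e.1 < k)%N && (e.2 == p e.1).
Proof.
case: e => i j /=; apply/imsetP/andP => [[m + [-> ->]]|[lik /eqP->]].
  by rewrite inE.
by exists i; rewrite ?inE.
Qed.

Lemma prefix0 n (p : 'S_n) : prefix p 0 = set0.
Proof. by apply/setP => e; rewrite in_prefix inE. Qed.

Lemma prefix_full n (p : 'S_n) : prefix p n = matching_edges p.
Proof. by apply/setP => e; rewrite in_prefix in_matching ltn_ord. Qed.

Lemma prefixS n (p : 'S_n) (i : 'I_n) :
  prefix p i.+1 = (i, p i) |: prefix p i.
Proof.
apply/setP => -[x y]; rewrite in_setU1 !in_prefix xpair_eqE /= ltnS leq_eqVlt.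
by rewrite andb_orl val_eqE; case: (eqVneq x i) => [->|].
Qed.

Lemma perfect_matchingP n (G : bigraph n) (p : 'S_n) :
  reflect (forall i, (i, p i) \in G) (perfect_matching G p).
Proof.
apply: (iffP subsetP) => [pG i | pG [i j]].
  by apply: pG; rewrite in_matching.
by rewrite in_matching /= => /eqP->.
Qed.

(** Restates admissibility through completions only, so that counting choices at
    row [i] becomes counting the values at [i] of the perfect matchings that
    agree with [p] before [i]. *)
Lemma mem_J n (G : bigraph n) (p : 'S_n) (i : 'I_n) (e : 'I_n * 'I_n) :
  reflect (exists q : 'S_n, [/\ perfect_matching G q,
             (forall m : 'I_n, (m < i)%N -> q m = p m) & e = (i, q i)])
          (e \in J G (prefix p i) i).
Proof.
rewrite inE; apply: (iffP and4P); last first.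
  case=> q [qG qp ->]; split=> //; first exact/perfect_matchingP.
    apply/imsetP => -[[m j]]; rewrite in_prefix /= => /andP[lmi /eqP->].
    by rewrite -qp // => /perm_inj eim; rewrite eim ltnn in lmi.
  apply/existsP; exists q; rewrite qG; apply/subsetP => -[m j].
  rewrite in_setU1 in_prefix in_matching xpair_eqE /=.
  by case/orP=> [/andP[/eqP-> ->//]|/andP[lmi /eqP->]]; rewrite qp.
case=> _ /eqP ei _ /existsP[q /andP[qG /subsetP Mq]].
exists q; split=> // [m lmi|].
  have: (m, p m) \in matching_edges q.
    by apply: Mq; rewrite in_setU1 in_prefix lmi eqxx orbT.
  by rewrite in_matching => /eqP.
have: e \in matching_edges q by apply: Mq; rewrite setU11.
by rewrite in_matching ei => /eqP <-; rewrite -ei; case: (e).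
Qed.

(** The current matching only grows, so a wrong edge is never undone. *)
Lemma output_prob_eq0 (R : realFieldType) n (G : bigraph n) (r : seq 'I_n)
    (M T : {set 'I_n * 'I_n}) :
  ~~ (M \subset T) -> output_prob R G r M T = 0.
Proof.
elim: r M => [|i r IHr] M nMT /=.
  by case: eqP nMT => // ->; rewrite subxx.
rewrite big1 // => e _; rewrite IHr ?mulr0 //.
by apply: contra nMT; apply/subset_trans/subsetUr.
Qed.

(** Of all the choices at a row, only the edge of [p] can still lead to [p]. *)
Lemma output_prob_prefix (R : realFieldType) n (G : bigraph n) (p : 'S_n) k :
    perfect_matching G p -> (k <= n)%N ->
  output_prob R G (drop k (enum 'I_n)) (prefix p k) (matching_edges p) =
    \prod_(i <- drop k (enum 'I_n)) #|J G (prefix p i) i|%:R^-1.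
Proof.
move=> pG; have [d] := ubnP (n - k)%N; elim: d k => // d IHd k ltd lekn.
have [ltkn|lenk] := ltnP k n; last first.
  have -> : k = n by lia.
  by rewrite drop_oversize ?size_enum_ord // big_nil prefix_full /= eqxx.
rewrite (drop_nth (Ordinal ltkn)) ?size_enum_ord //.
rewrite (nth_ord_enum _ (Ordinal ltkn)) big_cons /=.
set i := Ordinal ltkn; rewrite -[k]/(nat_of_ord i).
rewrite (bigD1 (i, p i)) /=; last by apply/mem_J; exists p.
rewrite big1 ?addr0 => [|e /andP[/mem_J[q [_ _ ->]] neq]].
  by rewrite -prefixS IHd //=; lia.
rewrite output_prob_eq0 ?mulr0 //; apply: contra neq => /subsetP/(_ (i, q i)).
by rewrite setU11 in_matching /= => /(_ isT)/eqP->.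
Qed.

Lemma mu_prod (R : realFieldType) n (G : bigraph n) (p : 'S_n) :
    perfect_matching G p ->
  mu R G p = \prod_(i < n) #|J G (prefix p i) i|%:R^-1.
Proof.
move=> pG; have := @output_prob_prefix R n G p 0 pG isT.
by rewrite drop0 prefix0 /mu => ->; rewrite big_enum.
Qed.

(** * Admissible edges in type-(s,t) graphs *)

Lemma in_type_graph s t n (i j : 'I_n) :
  ((i, j) \in type_graph s t n) = (i <= j + s)%N && (j <= i + t)%N.
Proof. rewrite inE /=; lia. Qed.

Lemma card_ord_ltn n c : #|[set j : 'I_n | (j < c)%N]| = minn c n.
Proof.
have le_n : (minn c n <= n)%N by exact: geq_minr.
have inj_w : injective (widen_ord le_n) by move=> x y [/val_inj].
rewrite -[RHS]card_ord -(card_imset _ inj_w).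
apply: eq_card => j; rewrite inE; apply/idP/imsetP => [ltjc|[m _ ->] /=].
  have ltj : (j < minn c n)%N by rewrite leq_min ltjc ltn_ord.
  by exists (Ordinal ltj) => //; apply: val_inj.
by have := ltn_ord m; rewrite leq_min => /andP[].
Qed.

(** Rows [>= k] currently carry arbitrary columns, the last hypothesis being
    that none of the columns left of [k - s] is free. Row [k] is exchanged with the
    row carrying the smallest free column. All columns that remain free are
    then strictly larger, which restores the hypothesis at [k + 1]. *)
Lemma greedy_completion s t n k (q : 'S_n) : (k <= n)%N ->
    (forall m : 'I_n, (m < k)%N -> (m, q m) \in type_graph s t n) ->
    (forall m : 'I_n, (k <= m)%N -> (k <= q m + s)%N) ->
  exists2 q' : 'S_n, perfect_matching (type_graph s t n) q' &
    forall m : 'I_n, (m < k)%N -> q' m = q m.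
Proof.
have [d] := ubnP (n - k)%N; elim: d k q => // d IHd k q ltd lekn qG qs.
have [ltkn|lenk] := ltnP k n; last first.
  exists q => //; apply/perfect_matchingP => i; apply: qG.
  exact: leq_trans lenk.
pose i := Ordinal ltkn.
have [m lekm qmin] := @arg_minnP _ i (fun m : 'I_n => (k <= m)%N)
  (fun m => q m) (leqnn k).
(* Columns below the smallest free one are occupied by the first k rows. *)
have qmk : (q m <= k)%N.
  have: [set j : 'I_n | (j < q m)%N] \subset q @: [set x : 'I_n | (x < k)%N].
    apply/subsetP => j; rewrite inE => ltj.
    apply/imsetP; exists (q^-1 j)%g; last by rewrite permKV.
    by rewrite inE ltnNge; apply: contraL ltj => /qmin; rewrite permKV leqNgt.
  move/subset_leq_card; rewrite card_imset; last exact: perm_inj.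
  by rewrite !card_ord_ltn; have := ltn_ord (q m); lia.
pose q1 := (tperm i m * q)%g.
have q1k (x : 'I_n) : (x < k)%N -> q1 x = q x.
  move=> ltxk; rewrite permM tpermD //;
    by apply: contraTneq ltxk => <-; rewrite -leqNgt.
have q1i : q1 i = q m by rewrite permM tpermL.
(* The side conditions for k + 1: the new edge at row k lies in the graph, and
   the columns of the later rows exceed q m. *)
have [|x|x ltkx|q' q'G q'q1] := IHd k.+1 q1 _ ltkn; first by lia.
- rewrite ltnS leq_eqVlt => /predU1P[xk|ltxk]; last by rewrite q1k ?qG.
  have -> : x = i by apply: val_inj.
  by rewrite q1i in_type_graph qs //= (leq_trans qmk) ?leq_addr.
- have lekm1 : (k <= tperm i m x)%N.
    by case: tpermP => // _; rewrite ltnW.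
  have := qmin _ lekm1; rewrite -permM -/q1 -q1i.
  rewrite leq_eqVlt => /predU1P[/val_inj|].
    by move/perm_inj => eix; rewrite -eix ltnn in ltkx.
  by have := qs m lekm; rewrite -q1i; lia.
exists q' => // x ltxk; rewrite q'q1 ?q1k //; exact: ltnW.
Qed.

Lemma perfect_type_graph s t n (p : 'S_n) (i : 'I_n) :
  perfect_matching (type_graph s t n) p -> (i <= p i + s)%N /\ (p i <= i + t)%N.
Proof. by move/perfect_matchingP/(_ i); rewrite in_type_graph => /andP[]. Qed.

(** In any completion the row matched to column [p i = i - s] is at most [i],
    and it is not an earlier row since those agree with [p]. *)
Lemma J_forced s t n (p : 'S_n) (i : 'I_n) :
    perfect_matching (type_graph s t n) p -> (i = p i + s :> nat)%N ->
  J (type_graph s t n) (prefix p i) i = [set (i, p i)].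
Proof.
move=> pG ei; apply/setP => e; rewrite in_set1.
apply/mem_J/eqP => [[q [qG qp ->]]|->]; last by exists p.
have /perfect_matchingP/(_ (q^-1 (p i))%g) := qG.
rewrite permKV in_type_graph -ei => /andP[].
rewrite leq_eqVlt => /predU1P[/val_inj/(congr1 q)|lti _].
  by rewrite permKV => ->.
have := qp _ lti; rewrite permKV => /perm_inj eii.
by rewrite -eii ltnn in lti.
Qed.

(** To choose a free column [j] at row [i], exchange the columns [p i] and [j];
    the column [p i] released to a later row is right of [i - s], so greedy
    completion applies from row [i + 1] on. *)
Lemma J_free s t n (p : 'S_n) (i : 'I_n) :
    perfect_matching (type_graph s t n) p -> (i < p i + s)%N ->
  J (type_graph s t n) (prefix p i) i =
    [set (i, j) | j in [set j : 'I_n | (j < (i + t).+1)%N]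
                         :\: p @: [set m : 'I_n | (m < i)%N]].
Proof.
move=> pG lti; apply/setP => e; apply/mem_J/imsetP => [[q [qG qp ->]]|[j]].
  exists (q i) => //; rewrite !inE ltnS; apply/andP; split.
    apply/imsetP => -[m]; rewrite inE => ltm; rewrite -qp // => /perm_inj eim.
    by rewrite eim ltnn in ltm.
  by have [] := perfect_type_graph _ _ _ _ i qG.
rewrite !inE ltnS => /andP[nj lej] ->.
pose m := (p^-1 j)%g.
have lem : (i <= m)%N.
  rewrite leqNgt; apply: contra nj => ltm.
  by apply/imsetP; exists m; rewrite ?inE ?permKV.
pose q := (tperm i m * p)%g.
have qp (x : 'I_n) : (x < i)%N -> q x = p x.
  move=> ltx; rewrite permM tpermD //;
    by apply: contraTneq ltx => <-; rewrite -leqNgt.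
have qi : q i = j by rewrite permM tpermL permKV.
have [|x|x ltx|q' q'G q'q] := @greedy_completion s t n i.+1 q.
- exact: ltn_ord.
- rewrite ltnS leq_eqVlt => /predU1P[/val_inj->|ltx].
    rewrite qi in_type_graph lej andbT.
    by have [] := perfect_type_graph _ _ _ _ m pG; rewrite permKV; lia.
  by rewrite qp //; have /perfect_matchingP := pG.
- by rewrite permM; case: tpermP ltx => [->|_|_ _] //; rewrite ?ltnn // => ltx;
    have [] := perfect_type_graph _ _ _ _ x pG; lia.
exists q'; split=> // [x ltx|]; first by rewrite q'q ?qp //; exact: ltnW.
by rewrite q'q ?qi.
Qed.

Lemma card_J s t n (p : 'S_n) (i : 'I_n) :
    perfect_matching (type_graph s t n) p ->
  #|J (type_graph s t n) (prefix p i) i| = if X s p i is 0 then Y t i else 1%N.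
Proof.
move=> pG; rewrite /X; case: eqP => /= [ei|nei].
  by rewrite J_forced ?cards1 //; lia.
have lti : (i < p i + s)%N.
  by have [] := perfect_type_graph _ _ _ _ i pG; lia.
rewrite J_free // card_imset; last by move=> x y [].
rewrite cardsDS; last first.
  apply/subsetP => _ /imsetP[m + ->]; rewrite !inE => ltm.
  by have [] := perfect_type_graph _ _ _ _ m pG; lia.
rewrite card_imset; last exact: perm_inj.
by rewrite !card_ord_ltn /Y; have := ltn_ord i; lia.
Qed.

Lemma mu_type_graph (R : realFieldType) s t n (p : 'S_n) :
    perfect_matching (type_graph s t n) p ->
  mu R (type_graph s t n) p =
    \prod_(i < n) ((Y t i)%:R ^+ X s p i / (Y t i)%:R).
Proof.
move=> pG; rewrite mu_prod //; apply: eq_bigr => i _; rewrite card_J //.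
have Y_neq0 : (Y t i)%:R != 0 :> R.
  by rewrite pnatr_eq0 /Y; have := ltn_ord i; lia.
by rewrite /X; case: eqP => _ /=; rewrite ?expr0 ?expr1 ?mul1r // invr1 divff.
Qed.

(** * The product of the weights Y *)

Lemma prod_Y_rev t n : (\prod_(i < n) Y t i = \prod_(i < n) minn t.+1 i.+1)%N.
Proof.
rewrite (reindex_inj rev_ord_inj); apply: eq_bigr => i _ /=.
by rewrite /Y /=; have := ltn_ord i; lia.
Qed.

Lemma prod_Y_le t n : (n <= t)%N -> (\prod_(i < n) Y t i = n`!)%N.
Proof.
move=> lent; rewrite prod_Y_rev fact_prod big_add1 /= big_mkord.
apply: eq_bigr => i _; have := ltn_ord i; lia.
Qed.

Lemma prod_Y_ge t n : (t <= n)%N ->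
  (\prod_(i < n) Y t i = t`! * t.+1 ^ (n - t))%N.
Proof.
elim: n => [|n IHn]; first by case: t => // _; rewrite big_ord0 fact0.
rewrite leq_eqVlt => /predU1P[->|letn].
  by rewrite prod_Y_le // subnn muln1.
rewrite prod_Y_rev big_ord_recr /= -prod_Y_rev IHn // subSn // expnSr mulnA.
by congr muln; lia.
Qed.

Lemma prod_Y_lower t n : (t.+1 ^ n <= t.+1 ^ t * \prod_(i < n) Y t i)%N.
Proof.
have [letn|/ltnW lent] := leqP t n.
  by rewrite prod_Y_ge // mulnCA -expnD subnKC // leq_pmull ?fact_gt0.
rewrite prod_Y_le // (leq_trans (_ : _ <= t.+1 ^ t)%N) ?leq_pexp2l //.
by rewrite leq_pmulr ?fact_gt0.
Qed.

(** * The formula and the two bounds *)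

Theorem proposition3p1 (R : realFieldType) (s t : nat)
    (hs : (0 < s)%N) (ht : (0 < t)%N) :
  (forall (n : nat) (p : 'S_n),
     (t <= n)%N ->
     perfect_matching (type_graph s t n) p ->
     mu R (type_graph s t n) p =
       t.+1%:R ^ (t%:Z - n%:Z) / (t`!)%:R
       * \prod_(i < n) (Y t i)%:R ^+ X s p i)
  /\
  (exists c1 c2 : R,
     [/\ 0 < c1, 0 < c2
       & forall (n : nat) (p : 'S_n),
           perfect_matching (type_graph s t n) p ->
           c1 * t.+1%:R ^ ((theta s p)%:Z - n%:Z)
             <= mu R (type_graph s t n) p
             <= c2 * t.+1%:R ^ ((theta s p)%:Z - n%:Z)]).
Proof.
have t1_neq0 : t.+1%:R != 0 :> R by rewrite pnatr_eq0.
have t1_gt0 : 0 < t.+1%:R :> R by rewrite ltr0n.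
split=> [n p letn pG|].
  rewrite mu_type_graph // big_split /= prodfV mulrC; congr (_ * _).
  rewrite -natr_prod prod_Y_ge // natrM invfM natrX mulrC; congr (_ / _).
  by rewrite -opprB -invr_expz subzn.
have Y_gt0 n (i : 'I_n) : (0 < Y t i)%N by rewrite /Y; have := ltn_ord i; lia.
have Y_le n (i : 'I_n) : (Y t i <= t.+1)%N by exact: geq_minl.
have t1_theta n (p : 'S_n) : t.+1%:R ^ ((theta s p)%:Z - n%:Z) =
    (\prod_(i < n) t.+1%:R ^+ X s p i) / t.+1%:R ^+ n :> R.
  by rewrite expfzDr // -invr_expz prodrXr.
exists 1, (t.+1%:R ^+ t); split=> [||n p pG]; rewrite ?exprn_gt0 ?ltr01 //.
rewrite mu_type_graph // t1_theta; apply/andP; split.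
  rewrite mul1r -[n in _ ^+ n]card_ord -prodr_const -prodf_div.
  apply: ler_prod => i _; rewrite divr_ge0 ?exprn_ge0 ?ler0n //=.
  rewrite /X; case: eqP => _ /=.
    by rewrite !expr1 !divff ?pnatr_eq0 -?lt0n.
  by rewrite !mul1r lef_pV2 ?posrE ?ltr0n ?ler_nat.
rewrite big_split /= prodfV mulrCA ler_pM ?prodr_ge0 ?invr_ge0 ?prodr_ge0 //.
- by move=> i _; rewrite exprn_ge0 ?ler0n.
- by apply: ler_prod => i _; rewrite exprn_ge0 ?lerXn2r ?nnegrE ?ler0n ?ler_nat.
rewrite -natr_prod ler_pdivlMr ?exprn_gt0 // mulrC ler_pdivrMr.
  by rewrite -!natrX -natrM ler_nat prod_Y_lower.
by rewrite ltr0n prodn_gt0.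
Qed.
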